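(* (1) If $(\mathcal M,\mathcal W,\mathrm{Cof})$ is a left proper precofibration category, then: (a) any cofibration $A\to B$ with $A$ cofibrant is left proper; (b) any map of $\mathcal M$ factors as a left proper map followed by a weak equivalence; (c) trivial left proper maps are stable under pushout; (d) $(\mathcal M,\mathcal W,\mathrm{PrCof})$ is a precofibration category, where $\mathrm{PrCof}$ is the class of left proper maps. (2) If $(\mathcal M,\mathcal W,\mathrm{Fib})$ is a right proper prefibration category, then: (a) any fibration $A\to B$ with $B$ fibrant is right proper; (b) any map of $\mathcal M$ factors as a weak equivalence followed by a right proper map; (c) trivial right proper maps are stable under pullback; (d) $(\mathcal M,\mathcal W,\mathrm{PrFib})$ is a prefibration category, where $\mathrm{PrFib}$ is the class of right proper maps.
   Context: A precofibration category $(\mathcal M,\mathcal W,\mathrm{Cof})$ is a category $\mathcal M$ with two classes of maps, weak equivalences $\mathcal W$ and cofibrations $\mathrm{Cof}$ (a trivial cofibration is a map in both; $A$ is cofibrant if $\mathbf 0\to A$ is a cofibration, $\mathbf 0$ the initial object), such that: CF1: $\mathcal M$ has an initial object $\mathbf 0$, which is cofibrant; cofibrations are stable under composition; all isomorphisms are weak equivalences, and all isomorphisms with cofibrant domain are trivial cofibrations. CF2: if $gf$ is defined and two of $f,g,gf$ are weak equivalences, so is the third. CF3: for a cofibration $i:A\to B$ and a map $A\to C$ with $A,C$ cofibrant, (1) the pushout of $i$ along $A\to C$ exists and $C\to B\sqcup_A C$ is a cofibration; (2) if $i$ is a trivial cofibration, so is $C\to B\sqcup_A C$. CF4: any map $f:A\to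 B$ with $A$ cofibrant factors as $f=rf'$ with $f'$ a cofibration and $r$ a weak equivalence. It is left proper if for any cofibration $i:A\to B$ with $A$ cofibrant and any map $r:A\to C$ ($C$ arbitrary), the pushout $D=B\sqcup_AC$ exists in $\mathcal M$, and if $r$ is a weak equivalence then so is $B\to D$. Prefibration categories and right properness are the dual notions: $(\mathcal M,\mathcal W,\mathrm{Fib})$ is a (right proper) prefibration category if $(\mathcal M^{op},\mathcal W^{op},\mathrm{Fib}^{op})$ is a (left proper) precofibration category; $A$ is fibrant if the map from $A$ to the terminal object is a fibration. Left proper maps: a map $f:A\to B$ is left proper (with respect to $\mathcal W$) if for any maps $A\to C_1\xrightarrow{r}C_2$ with $r$ a weak equivalence, the pushouts $D_1=B\sqcup_AC_1$ and $D_2=B\sqcup_AC_2$ exist and the induced map $D_1\to D_2$ is a weak equivalence. Right proper maps are defined dually, with pullbacks. A trivial left (right) proper map is a left (right) proper map that is a weak equivalence. *)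

(* Defs.v *)
Set Implicit Arguments.
Unset Strict Implicit.
Unset Printing Implicit Defensive.

Record Category : Type := {
  Ob :> Type;
  Hom : Ob -> Ob -> Type;
  idm : forall a : Ob, Hom a a;
  comp : forall a b c : Ob, Hom b c -> Hom a b -> Hom a c;
  comp_id_l : forall (a b : Ob) (f : Hom a b), comp (idm b) f = f;
  comp_id_r : forall (a b : Ob) (f : Hom a b), comp f (idm a) = f;
  comp_assoc : forall (a b c d : Ob) (h : Hom c d) (g : Hom b c) (f : Hom a b),
    comp h (comp g f) = comp (comp h g) f
}.

Arguments Hom {_} _ _.
Arguments idm {_} _.
Arguments comp {_ _ _ _} _ _.

Notation "g ∘ f" := (comp g f) (at level 40, left associativity).

Definition op (M : Category) : Category := {|
  Ob := Ob M;
  Hom := fun a b => @Hom M b a;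
  idm := fun a => @idm M a;
  comp := fun a b c g f => @comp M c b a f g;
  comp_id_l := fun a b f => @comp_id_r M b a f;
  comp_id_r := fun a b f => @comp_id_l M b a f;
  comp_assoc := fun a b c d h g f => eq_sym (@comp_assoc M d c b a f g h)
|}.

Definition MorClass (M : Category) : Type := forall a b : M, Hom a b -> Prop.

Definition opclass {M : Category} (P : MorClass M) : MorClass (op M) :=
  fun a b f => P b a f.

Definition trivial {M : Category} (W P : MorClass M) : MorClass M :=
  fun a b f => P a b f /\ W a b f.

Definition is_iso {M : Category} {a b : M} (f : Hom a b) : Prop :=
  exists g : Hom b a, g ∘ f = idm a /\ f ∘ g = idm b.

Definition is_initial {M : Category} (z : M) : Prop :=
  forall x : M, exists! f : Hom z x, True.

Definition is_terminal {M : Category} (t : M) : Prop :=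
  forall x : M, exists! f : Hom x t, True.

(** The square
<<
      A --u--> C
      |        |
      i        j
      v        v
      B --v--> D
>>
    is a pushout. *)
Definition is_pushout {M : Category} {A B C D : M} (i : Hom A B) (u : Hom A C)
    (v : Hom B D) (j : Hom C D) : Prop :=
  v ∘ i = j ∘ u /\
  forall (X : M) (p : Hom B X) (q : Hom C X), p ∘ i = q ∘ u ->
    exists! d : Hom D X, d ∘ v = p /\ d ∘ j = q.

Definition has_pushout {M : Category} {A B C : M} (i : Hom A B) (u : Hom A C)
    : Prop :=
  exists (D : M) (v : Hom B D) (j : Hom C D), is_pushout i u v j.

(** The square
<<
      D --v--> B
      |        |
      j        p
      v        v
      C --u--> A
>>
    is a pullback. *)
Definition is_pullback {M : Category} {A B C D : M} (p : Hom B A) (u : Hom C A)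
    (v : Hom D B) (j : Hom D C) : Prop :=
  p ∘ v = u ∘ j /\
  forall (X : M) (s : Hom X B) (t : Hom X C), p ∘ s = u ∘ t ->
    exists! d : Hom X D, v ∘ d = s /\ j ∘ d = t.

Definition has_pullback {M : Category} {A B C : M} (p : Hom B A) (u : Hom C A)
    : Prop :=
  exists (D : M) (v : Hom D B) (j : Hom D C), is_pullback p u v j.

Definition stable_under_pushout {M : Category} (P : MorClass M) : Prop :=
  forall (A B C : M) (i : Hom A B) (u : Hom A C), P A B i ->
    has_pushout i u /\
    forall (D : M) (v : Hom B D) (j : Hom C D), is_pushout i u v j -> P C D j.

Definition stable_under_pullback {M : Category} (P : MorClass M) : Prop :=
  forall (A B C : M) (p : Hom B A) (u : Hom C A), P B A p ->
    has_pullback p u /\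
    forall (D : M) (v : Hom D B) (j : Hom D C), is_pullback p u v j -> P D C j.

(** No initial object is chosen: the condition is imposed on the map from every
    initial object.  For a precofibration category this is equivalent to
    imposing it for one fixed initial object, since isomorphisms with cofibrant
    domain are cofibrations and cofibrations compose. *)
Definition cofibrant {M : Category} (Cof : MorClass M) (A : M) : Prop :=
  forall z : M, is_initial z -> forall f : Hom z A, Cof z A f.

Definition fibrant {M : Category} (Fib : MorClass M) (A : M) : Prop :=
  forall t : M, is_terminal t -> forall f : Hom A t, Fib A t f.

Record precofibration_category {M : Category} (W Cof : MorClass M) : Prop := {
  CF1_initial : exists z : M, is_initial z /\ cofibrant Cof z;
  CF1_comp : forall (a b c : M) (g : Hom b c) (f : Hom a b),
    Cof a b f -> Cof b c g -> Cof a c (g ∘ f);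
  CF1_iso_W : forall (a b : M) (f : Hom a b), is_iso f -> W a b f;
  CF1_iso_Cof : forall (a b : M) (f : Hom a b),
    is_iso f -> cofibrant Cof a -> trivial W Cof f;
  CF2_comp : forall (a b c : M) (g : Hom b c) (f : Hom a b),
    W a b f -> W b c g -> W a c (g ∘ f);
  CF2_left : forall (a b c : M) (g : Hom b c) (f : Hom a b),
    W a b f -> W a c (g ∘ f) -> W b c g;
  CF2_right : forall (a b c : M) (g : Hom b c) (f : Hom a b),
    W b c g -> W a c (g ∘ f) -> W a b f;
  CF3_exists : forall (A B C : M) (i : Hom A B) (u : Hom A C),
    cofibrant Cof A -> cofibrant Cof C -> Cof A B i -> has_pushout i u;
  CF3_Cof : forall (A B C : M) (i : Hom A B) (u : Hom A C),
    cofibrant Cof A -> cofibrant Cof C -> Cof A B i ->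
    forall (D : M) (v : Hom B D) (j : Hom C D),
      is_pushout i u v j -> Cof C D j;
  CF3_trivial : forall (A B C : M) (i : Hom A B) (u : Hom A C),
    cofibrant Cof A -> cofibrant Cof C -> trivial W Cof i ->
    forall (D : M) (v : Hom B D) (j : Hom C D),
      is_pushout i u v j -> trivial W Cof j;
  CF4 : forall (A B : M) (f : Hom A B), cofibrant Cof A ->
    exists (B' : M) (f' : Hom A B') (r : Hom B' B),
      Cof A B' f' /\ W B' B r /\ f = r ∘ f'
}.

Record left_proper_precofibration_category {M : Category} (W Cof : MorClass M)
    : Prop := {
  lp_precofibration : precofibration_category W Cof;
  lp_pushout : forall (A B C : M) (i : Hom A B) (r : Hom A C),
    cofibrant Cof A -> Cof A B i -> has_pushout i r;
  lp_W : forall (A B C : M) (i : Hom A B) (r : Hom A C),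
    cofibrant Cof A -> Cof A B i -> W A C r ->
    forall (D : M) (v : Hom B D) (j : Hom C D),
      is_pushout i r v j -> W B D v
}.

Definition prefibration_category {M : Category} (W Fib : MorClass M) : Prop :=
  precofibration_category (opclass W) (opclass Fib).

Definition right_proper_prefibration_category {M : Category}
    (W Fib : MorClass M) : Prop :=
  left_proper_precofibration_category (opclass W) (opclass Fib).

(** The map [d] below is the map [D1 -> D2] induced by [r]; it is uniquely
    determined by the two equations. *)
Definition left_proper {M : Category} (W : MorClass M) : MorClass M :=
  fun A B f =>
  forall (C1 C2 : M) (u : Hom A C1) (r : Hom C1 C2), W C1 C2 r ->
    has_pushout f u /\ has_pushout f (r ∘ u) /\
    forall (D1 D2 : M) (v1 : Hom B D1) (j1 : Hom C1 D1)
      (v2 : Hom B D2) (j2 : Hom C2 D2),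
      is_pushout f u v1 j1 -> is_pushout f (r ∘ u) v2 j2 ->
      forall d : Hom D1 D2, d ∘ v1 = v2 -> d ∘ j1 = j2 ∘ r -> W D1 D2 d.

Definition right_proper {M : Category} (W : MorClass M) : MorClass M :=
  fun B A f =>
  forall (C1 C2 : M) (u : Hom C1 A) (r : Hom C2 C1), W C2 C1 r ->
    has_pullback f u /\ has_pullback f (u ∘ r) /\
    forall (D1 D2 : M) (v1 : Hom D1 B) (j1 : Hom D1 C1)
      (v2 : Hom D2 B) (j2 : Hom D2 C2),
      is_pullback f u v1 j1 -> is_pullback f (u ∘ r) v2 j2 ->
      forall d : Hom D2 D1, v1 ∘ d = v2 -> j1 ∘ d = r ∘ j2 -> W D2 D1 d.

Lemma fibrant_op (M : Category) (Fib : MorClass M) (A : M) :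
  fibrant Fib A = @cofibrant (op M) (opclass Fib) A.
Proof. reflexivity. Qed.

Lemma right_proper_op (M : Category) (W : MorClass M) :
  opclass (right_proper W) = left_proper (opclass W).
Proof. reflexivity. Qed.

Lemma stable_under_pullback_op (M : Category) (P : MorClass M) :
  stable_under_pullback P = stable_under_pushout (opclass P).
Proof. reflexivity. Qed.

(* Main.v *)
(** By pasting pushout squares, a map [f] is left proper exactly when all its
    pushouts exist and cobase change along each pushout of [f] preserves weak
    equivalences.  In this form left proper maps are visibly stable under
    pushout and composition.  A pushout of a cofibration [A -> B] along
    [A -> C], with [A] cofibrant, can be computed in two steps by factoring
    [A -> C] as a cofibration [A -> C'] and a weak equivalence [C' -> C]; since
    [C'] is cofibrant, left properness of the category applies to the second
    step, whence (a).  Factorizations of an arbitrary map are pushed out from a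
    cofibrant replacement of its domain, and the same two-step computation
    gives (c).  Part (2) is part (1) in the opposite category. *)

Require Import Defs.

Set Implicit Arguments.
Unset Strict Implicit.
Unset Printing Implicit Defensive.

(** * Calculus of pushout squares *)

Lemma pushout_sym {M : Category} {A B C D : M} {i : Hom A B} {u : Hom A C}
    {v : Hom B D} {j : Hom C D} :
  is_pushout i u v j -> is_pushout u i j v.
Proof.
intros [E U]; split; [now symmetry|].
intros X p q H; destruct (U X q p (eq_sym H)) as [d [[H1 H2] Hd]].
exists d; split; [now split|].
intros d' [H1' H2']; apply Hd; now split.
Qed.

Lemma pushout_ext {M : Category} {A B C D X : M} {i : Hom A B} {u : Hom A C}
    {v : Hom B D} {j : Hom C D} {d d' : Hom D X} :
  is_pushout i u v j -> d ∘ v = d' ∘ v -> d ∘ j = d' ∘ j -> d = d'.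
Proof.
intros [E U] Hv Hj.
assert (H : (d ∘ v) ∘ i = (d ∘ j) ∘ u)
  by now rewrite <- !comp_assoc, E.
destruct (U X _ _ H) as [e [_ He]].
transitivity e; [symmetry|]; apply He; split; auto.
Qed.

Lemma pushout_paste {M : Category} {A B C D E F : M} {i : Hom A B}
    {u : Hom A C} {v : Hom B D} {j : Hom C D} {s : Hom C E} {w : Hom D F}
    {k : Hom E F} :
  is_pushout i u v j -> is_pushout j s w k ->
  is_pushout i (s ∘ u) (w ∘ v) k.
Proof.
intros P Q; pose proof P as [EP UP]; pose proof Q as [EQ UQ]; split.
- now rewrite <- comp_assoc, EP, !comp_assoc, EQ.
- intros X p q H; rewrite comp_assoc in H.
  destruct (UP X p (q ∘ s) H) as [d [[dv dj] _]].
  destruct (UQ X d q dj) as [e [[ew ek] _]].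
  exists e; split.
  + split; [now rewrite comp_assoc, ew | exact ek].
  + intros e' [H1 H2]; rewrite comp_assoc in H1.
    apply (pushout_ext Q); [|now rewrite ek].
    apply (pushout_ext P); [now rewrite ew, dv|].
    now rewrite <- !comp_assoc, EQ, !comp_assoc, ek, H2.
Qed.

(** Converse to [pushout_paste]. It exhibits the comparison map between two pushouts of [i] as a
    cobase change of [s], the form in which left properness is applied. *)
Lemma pushout_cancel {M : Category} {A B C D E F : M} {i : Hom A B}
    {u : Hom A C} {v : Hom B D} {j : Hom C D} {s : Hom C E} {v' : Hom B F}
    {k : Hom E F} :
  is_pushout i u v j -> is_pushout i (s ∘ u) v' k ->
  exists w : Hom D F, w ∘ v = v' /\ is_pushout j s w k.
Proof.
intros P Q; pose proof P as [EP UP]; pose proof Q as [EQ UQ].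
assert (H := EQ); rewrite comp_assoc in H.
destruct (UP F _ _ H) as [w [[wv wj] _]].
exists w; split; [exact wv | split; [exact wj|]].
intros X p q Hpq.
assert (H' : (p ∘ v) ∘ i = q ∘ (s ∘ u))
  by now rewrite comp_assoc, <- Hpq, <- !comp_assoc, EP.
destruct (UQ X _ _ H') as [d [[dv dk] _]].
exists d; split.
- split; [|exact dk].
  apply (pushout_ext P); rewrite <- comp_assoc.
  + now rewrite wv.
  + now rewrite wj, comp_assoc, dk.
- intros d' [H1 H2]; apply (pushout_ext Q); [|now rewrite dk].
  now rewrite dv, <- H1, <- comp_assoc, wv.
Qed.

Lemma pushout_along_iso {M : Category} {A B C : M} (i : Hom A B) (u : Hom A C)
    (g : Hom C A) :
  g ∘ u = idm A -> u ∘ g = idm C -> is_pushout i u (idm B) (i ∘ g).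
Proof.
intros gu ug; split.
- now rewrite comp_id_l, <- comp_assoc, gu, comp_id_r.
- intros X p q H; exists p; split.
  + split; [apply comp_id_r|].
    now rewrite comp_assoc, H, <- comp_assoc, ug, comp_id_r.
  + intros d [Hd _]; now rewrite comp_id_r in Hd.
Qed.

Lemma iso_pushout {M : Category} {A B C D : M} {i : Hom A B} {u : Hom A C}
    {v : Hom B D} {j : Hom C D} :
  is_iso i -> is_pushout i u v j -> is_iso j.
Proof.
intros [g [gi ig]] P; pose proof P as [E U].
assert (H : (u ∘ g) ∘ i = idm C ∘ u)
  by now rewrite <- comp_assoc, gi, comp_id_r, comp_id_l.
destruct (U _ _ _ H) as [d [[dv dj] _]].
exists d; split; [exact dj|].
apply (pushout_ext P); rewrite <- comp_assoc, comp_id_l.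
- now rewrite dv, comp_assoc, <- E, <- comp_assoc, ig, comp_id_r.
- now rewrite dj, comp_id_r.
Qed.

Lemma is_iso_id {M : Category} (A : M) : is_iso (idm A).
Proof. exists (idm A); split; apply comp_id_l. Qed.

Lemma initial_iso {M : Category} {z z' : M} (f : Hom z z') :
  is_initial z -> is_initial z' -> is_iso f.
Proof.
intros Iz Iz'; destruct (Iz' z) as [g _].
exists g; split.
- destruct (Iz z) as [h [_ Hh]]; transitivity h; [symmetry|]; now apply Hh.
- destruct (Iz' z') as [h [_ Hh]]; transitivity h; [symmetry|]; now apply Hh.
Qed.

Lemma cofibrant_target {M : Category} (W Cof : MorClass M) {A B : M}
    (f : Hom A B) :
  precofibration_category W Cof -> cofibrant Cof A -> Cof A B f ->
  cofibrant Cof B.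
Proof.
intros PC cA cf z Iz h.
destruct (Iz A) as [a _]; destruct (Iz B) as [b [_ Hb]].
replace h with (f ∘ a).
- apply (CF1_comp PC); [now apply cA | exact cf].
- transitivity b; [symmetry|]; now apply Hb.
Qed.

(** * Closure properties of left proper maps in a precofibration category *)

Section LeftProperMaps.

Context {M : Category} {W Cof : MorClass M}.
Context (PC : precofibration_category W Cof).

Lemma left_properE {A B : M} (f : Hom A B) :
  left_proper W f <->
  (forall (C : M) (u : Hom A C), has_pushout f u) /\
  (forall (C1 C2 D1 D2 : M) (u : Hom A C1) (v : Hom B D1) (j : Hom C1 D1)
     (r : Hom C1 C2) (d : Hom D1 D2) (k : Hom C2 D2),
     is_pushout f u v j -> is_pushout j r d k -> W r -> W d).
Proof.
split.
- intros L; split.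
  + intros C u.
    exact (proj1 (L C C u (idm C) (CF1_iso_W PC (is_iso_id C)))).
  + intros C1 C2 D1 D2 u v j r d k P Q Wr.
    destruct (L _ _ u _ Wr) as [_ [_ K]].
    exact (K _ _ _ _ _ _ P (pushout_paste P Q) d eq_refl (proj1 Q)).
- intros [ex K] C1 C2 u r Wr.
  split; [apply ex | split; [apply ex|]].
  intros D1 D2 v1 j1 v2 j2 P1 P2 d dv dj.
  destruct (pushout_cancel P1 P2) as [w [wv Q]].
  (* The induced map [d] and the cobase change [w] of [r] agree on [B] and on [C1], hence
     coincide. *)
  replace d with w; [exact (K _ _ _ _ _ _ _ _ _ _ P1 Q Wr)|].
  apply (pushout_ext P1); [congruence|].
  rewrite dj; exact (proj1 Q).
Qed.

Lemma left_proper_pushout {A B C D : M} {f : Hom A B} {u : Hom A C}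
    {v : Hom B D} {j : Hom C D} :
  left_proper W f -> is_pushout f u v j -> left_proper W j.
Proof.
intros [ex K]%left_properE P; apply left_properE; split.
- intros E s; destruct (ex E (s ∘ u)) as [F [v' [k Q]]].
  destruct (pushout_cancel P Q) as [w [_ R]]; now exists F, w, k.
- intros C1 C2 D1 D2 u' v' j' r d k P' Q.
  exact (K _ _ _ _ _ _ _ _ _ _ (pushout_paste P P') Q).
Qed.

(** The map [f] is its own pushout along [idm A], so [v] is a cobase change of [r] to which the
    criterion applies. *)
Lemma left_proper_W {A B C D : M} {f : Hom A B} {r : Hom A C} {v : Hom B D}
    {j : Hom C D} :
  left_proper W f -> is_pushout f r v j -> W r -> W v.
Proof.
intros [_ K]%left_properE P.
assert (Q : is_pushout f (idm A) (idm B) (f ∘ idm A))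
  by (apply pushout_along_iso; apply comp_id_l).
rewrite comp_id_r in Q.
exact (K _ _ _ _ _ _ _ _ _ _ Q P).
Qed.

Lemma left_proper_comp {A B C : M} (g : Hom B C) (f : Hom A B) :
  left_proper W f -> left_proper W g -> left_proper W (g ∘ f).
Proof.
intros Lf Lg.
pose proof (proj1 (left_properE f) Lf) as [exf _].
pose proof (proj1 (left_properE g) Lg) as [exg Kg].
apply left_properE; split.
- intros X u.
  destruct (exf X u) as [D [v [j P]]]; destruct (exg D v) as [E [w [k Q]]].
  exists E, w, (k ∘ j).
  exact (pushout_sym (pushout_paste (pushout_sym P) (pushout_sym Q))).
- intros C1 C2 D1 D2 u v j r d k P Q Wr.
  destruct (exf C1 u) as [E1 [v1 [j1 P1]]].
  (* The pushout of [g ∘ f] splits as [j = e ∘ j1], with [j1] a pushout of [f] and [e] a pushout of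
     [g]. Pushing out along [r] then goes in two steps: [r] to [d1] across [j1], and [d1] to [d]
     across [e]. *)
  destruct (pushout_cancel (pushout_sym P1) (pushout_sym P)) as [e [ej Pg]].
  subst j.
  assert (Lj := left_proper_pushout Lf P1).
  destruct (proj1 (proj1 (left_properE j1) Lj) C2 r) as [E2 [d1 [k1 P2]]].
  destruct (pushout_cancel (pushout_sym P2) (pushout_sym Q)) as [e2 [_ R]].
  exact (Kg _ _ _ _ _ _ _ _ _ _ (pushout_sym Pg) (pushout_sym R)
           (left_proper_W Lj P2 Wr)).
Qed.

Lemma left_proper_iso {A B : M} (f : Hom A B) : is_iso f -> left_proper W f.
Proof.
intros If; apply left_properE; split.
- intros C u; destruct If as [g [gf fg]].
  exists C, (u ∘ g), (idm C).
  apply pushout_sym; now apply pushout_along_iso.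
- intros C1 C2 D1 D2 u v j r d k P Q Wr.
  (* In [d ∘ j = k ∘ r] both [j] and [k] are isomorphisms, so two-out-of-three passes from [r] to
     [d]. *)
  assert (Ij := iso_pushout If P); assert (Ik := iso_pushout Ij Q).
  apply (CF2_left PC) with (f := j); [exact (CF1_iso_W PC Ij)|].
  rewrite (proj1 Q).
  apply (CF2_comp PC); [exact Wr | exact (CF1_iso_W PC Ik)].
Qed.

End LeftProperMaps.

(** * Left proper maps in a left proper precofibration category *)

Section LeftProperCategory.

Context {M : Category} {W Cof : MorClass M}.
Context (LP : left_proper_precofibration_category W Cof).

Let PC : precofibration_category W Cof := lp_precofibration LP.

Lemma cofibration_left_proper {A B : M} (f : Hom A B) :
  Cof f -> cofibrant Cof A -> left_proper W f.
Proof.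
intros cf cA; apply (left_properE PC); split.
- intros C u; exact (lp_pushout LP u cA cf).
- intros C1 C2 D1 D2 u v j r d k P Q Wr.
  destruct (CF4 PC u cA) as [C' [u' [s [cu' [Ws Hu]]]]]; subst u.
  assert (cC' := cofibrant_target PC cA cu').
  destruct (lp_pushout LP u' cA cf) as [D' [v' [j' P']]].
  assert (cj' := CF3_Cof PC cA cC' cf P').
  destruct (pushout_cancel P' P) as [e [_ R]].
  (* Both [e] and [d ∘ e] are cobase changes, of [s] and [r ∘ s], along the cofibration [j'] with
     cofibrant domain [C']. *)
  apply (CF2_left PC) with (f := e).
  + exact (lp_W LP cC' cj' Ws R).
  + exact (lp_W LP cC' cj' (CF2_comp PC Ws Wr) (pushout_paste R Q)).
Qed.

Lemma left_proper_factorization {A B : M} (f : Hom A B) :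
  exists (B' : M) (f' : Hom A B') (r : Hom B' B),
    left_proper W f' /\ W r /\ f = r ∘ f'.
Proof.
destruct (CF1_initial PC) as [z [Iz cz]].
destruct (Iz A) as [a _].
(* [w] is a cofibrant replacement of [A]. The cofibration part of [f ∘ w] is pushed out along [w],
   giving the left proper factor [j]; [r'] and [f] induce the weak equivalence [d]. *)
destruct (CF4 PC a cz) as [A' [a' [w [ca' [Ww _]]]]].
assert (cA' := cofibrant_target PC cz ca').
destruct (CF4 PC (f ∘ w) cA') as [B' [f' [r' [cf' [Wr' E]]]]].
destruct (lp_pushout LP w cA' cf') as [D [v [j P]]].
destruct (proj2 P B r' f (eq_sym E)) as [d [[dv dj] _]].
exists D, j, d; split; [|split].
- exact (left_proper_pushout PC (cofibration_left_proper cf' cA') P).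
- apply (CF2_left PC) with (f := v); [exact (lp_W LP cA' cf' Ww P)|].
  now rewrite dv.
- now symmetry.
Qed.

Lemma trivial_left_proper_stable :
  stable_under_pushout (trivial W (left_proper W)).
Proof.
intros A B C f u [Lf Wf].
pose proof (proj1 (left_properE PC f) Lf) as [ex _].
split; [apply ex|].
intros D v j P; split; [exact (left_proper_pushout PC Lf P)|].
destruct (left_proper_factorization u) as [C' [u' [s [Lu' [Ws Hu]]]]]; subst u.
destruct (ex C' u') as [D' [v' [j' P']]].
destruct (pushout_cancel P' P) as [e [_ R]].
(* In [e ∘ j' = j ∘ s], [j'] is a weak equivalence as the cobase change of [f] along the left proper
   [u'], and [e] as that of [s] along the left proper [j']. *)
apply (CF2_left PC) with (f := s); [exact Ws|].
rewrite <- (proj1 R); apply (CF2_comp PC).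
- exact (left_proper_W PC Lu' (pushout_sym P') Wf).
- exact (left_proper_W PC (left_proper_pushout PC Lf P') R Ws).
Qed.

Lemma left_proper_precofibration :
  precofibration_category W (left_proper W).
Proof.
constructor.
- destruct (CF1_initial PC) as [z [Iz _]].
  exists z; split; [exact Iz|].
  (* A map between initial objects is an isomorphism, hence left proper. *)
  intros z' Iz' f; apply (left_proper_iso PC); now apply initial_iso.
- intros a b c g f Lf Lg; exact (left_proper_comp PC Lf Lg).
- exact (CF1_iso_W PC).
- intros a b f If _; split;
    [exact (left_proper_iso PC If) | exact (CF1_iso_W PC If)].
- exact (CF2_comp PC).
- exact (CF2_left PC).
- exact (CF2_right PC).
- intros A B C i u _ _ Li; exact (proj1 (proj1 (left_properE PC i) Li) C u).
- intros A B C i u _ _ Li D v j; exact (left_proper_pushout PC Li).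
- intros A B C i u _ _ [Li Wi].
  exact (proj2 (trivial_left_proper_stable u (conj Li Wi))).
- intros A B f _; exact (left_proper_factorization f).
Qed.

End LeftProperCategory.

Theorem theorem1p8p4 :
  (forall (M : Category) (W Cof : MorClass M),
    left_proper_precofibration_category W Cof ->
    (forall (A B : M) (f : Hom A B),
       Cof A B f -> cofibrant Cof A -> left_proper W f) /\
    (forall (A B : M) (f : Hom A B),
       exists (B' : M) (f' : Hom A B') (r : Hom B' B),
         left_proper W f' /\ W B' B r /\ f = r ∘ f') /\
    stable_under_pushout (trivial W (left_proper W)) /\
    precofibration_category W (left_proper W)) /\
  (forall (M : Category) (W Fib : MorClass M),
    right_proper_prefibration_category W Fib ->
    (forall (A B : M) (f : Hom A B),
       Fib A B f -> fibrant Fib B -> right_proper W f) /\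
    (forall (A B : M) (f : Hom A B),
       exists (A' : M) (r : Hom A A') (f' : Hom A' B),
         W A A' r /\ right_proper W f' /\ f = f' ∘ r) /\
    stable_under_pullback (trivial W (right_proper W)) /\
    prefibration_category W (right_proper W)).
Proof.
split.
- intros M W Cof LP; split; [|split; [|split]].
  + intros A B f; exact (cofibration_left_proper LP (f := f)).
  + intros A B f; exact (left_proper_factorization LP f).
  + exact (trivial_left_proper_stable LP).
  + exact (left_proper_precofibration LP).
- intros M W Fib RP; split; [|split; [|split]].
  + intros A B f cf cB.
    exact (@cofibration_left_proper (op M) _ _ RP B A f cf cB).
  + intros A B f.
    destruct (@left_proper_factorization (op M) _ _ RP B A f)
      as [A' [f' [r [Lf' [Wr E]]]]].
    exists A', r, f'; split; [exact Wr | split; [exact Lf' | exact E]].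
  + exact (@trivial_left_proper_stable (op M) _ _ RP).
  + exact (@left_proper_precofibration (op M) _ _ RP).
Qed.
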